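(* Let $K$ be a field containing $\mathbb{Q}$ and let $r\in\widetilde{K}$. Then there exist an integer $m\geq 1$ and a polynomial $T(x,x_1,\dots,x_m)\in\mathbb{Q}[x,x_1,\dots,x_m]$ such that for all $x\in K$: $x=r$ if and only if there exist $x_1,\dots,x_m\in K$ with $T(x,x_1,\dots,x_m)=0$.
   Context: Let $K$ be a field. For $r\in K$, a finite set $A(r)$ with $\{r\}\subseteq A(r)\subseteq K$ is called adequate for $r$ if every mapping $f:A(r)\to K$ satisfying (1) if $1\in A(r)$ then $f(1)=1$; (2) if $a,b\in A(r)$ and $a+b\in A(r)$ then $f(a+b)=f(a)+f(b)$; (3) if $a,b\in A(r)$ and $a\cdot b\in A(r)$ then $f(a\cdot b)=f(a)\cdot f(b)$, also satisfies $f(r)=r$. $\widetilde{K}$ denotes the set of all $r\in K$ for which some finite set adequate for $r$ exists. *)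

(* Defs.v *)
From HB Require Import structures.
From mathcomp Require Import all_boot all_order all_algebra.
From mathcomp Require Import mpoly.
Set Implicit Arguments. Unset Strict Implicit. Unset Printing Implicit Defensive.
Import GRing.Theory.
Local Open Scope ring_scope.

(* A finite set A (given by a finite list of elements of K) is adequate for r
   if r \in A and every map f : A -> K satisfying conditions (1)-(3) fixes r.
   Maps A -> K are represented by functions K -> K (only values on A matter). *)
Definition adequate (K : fieldType) (r : K) (A : seq K) : Prop :=
  r \in A /\
  forall f : K -> K,
    (1 \in A -> f 1 = 1) ->
    (forall a b, a \in A -> b \in A -> a + b \in A -> f (a + b) = f a + f b) ->
    (forall a b, a \in A -> b \in A -> a * b \in A -> f (a * b) = f a * f b) ->
    f r = r.

Definition tildeK (K : fieldType) (r : K) : Prop :=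
  exists A : seq K, adequate r A.

Definition valx (K : fieldType) (m : nat) (x : K) (xs : 'I_m -> K) :
  'I_m.+1 -> K :=
  fun i => if unlift ord0 i is Some j then xs j else x.

Definition evalQ (K : fieldType) (m : nat) (T : {mpoly rat[m.+1]})
  (x : K) (xs : 'I_m -> K) : K :=
  mmap (fun c : rat => ratr c) (valx x xs) T.

(* Main.v *)
Require Import Defs.
From HB Require Import structures.
From mathcomp Require Import all_boot all_order all_algebra all_field.
From mathcomp Require Import ring.
From mathcomp Require Import mpoly.
From Stdlib Require Import Classical_Prop.
Import GRing.Theory.
Local Open Scope ring_scope.

(* Finitely many polynomial equations over Q say that f is a map as in the
   definition of adequacy and that x = f(r).  If some nonconstant p in Q[X] has
   no root in K, the homogenization of p vanishes only at (0, 0), which merges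
   the equations into one.  Otherwise r is rational, and T = x - r works: the
   ring Q[A] generated by an adequate set A would, for irrational r, have two
   homomorphisms to the algebraic numbers with different values at r (extend
   from Q[r] one generator at a time, as in Zariski's lemma).  Their values on
   A lie in a number field Q(z), and a root in K of the minimal polynomial of z
   embeds that field in K; the two resulting maps A -> K cannot both fix r. *)

(** [Q] need not be decidable, so the descent on the size uses excluded middle. *)
Lemma ex_min_size (R : nzRingType) (Q : {poly R} -> Prop) :
  (exists q, Q q) ->
  exists q, Q q /\ forall q', Q q' -> (size q <= size q')%N.
Proof.
case=> q Qq.
have [n] := ubnP (size q); elim: n q Qq => // n IHn q Qq lt_q_n.
have [[q' [Qq' lt_q'q]]|min_q] :=
  classic (exists q', Q q' /\ (size q' < size q)%N).
  exact: IHn Qq' (leq_trans lt_q'q lt_q_n).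
exists q; split=> // q' Qq'; rewrite leqNgt; apply/negP=> lt_q'q.
by apply: min_q; exists q'.
Qed.

(** * Extending a specialization to one more generator *)

Section Specialization.

Variables (R : idomainType) (K : fieldType) (Om : closedFieldType).
Variables (al : {rmorphism R -> K}) (x : K).

(** Kernel inclusion: a morphism [be] with this property factors through the image of [al]. It thus
    stands for a homomorphism to [Om] from the subring [al(R)] of [K], without that subring being
    constructed. *)
Definition specializes (be : R -> Om) := forall t, al t = 0 -> be t = 0.

Lemma specializes_map_poly (be : {rmorphism R -> Om}) q :
  specializes be -> map_poly al q = 0 -> map_poly be q = 0.
Proof.
move=> spec q0; apply/polyP=> i; rewrite coef_map coef0; apply: spec.
by rewrite -coef_map q0 coef0.
Qed.

(** Up to a scalar, the image of [P] is the minimal polynomial of [x] over the fraction field of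
    [al(R)]. No denominators occur, and the size is measured before applying [al]. *)
Definition minimal_relation (P : {poly R}) :=
  [/\ (map_poly al P).[x] = 0, map_poly al P != 0
    & forall q, (map_poly al q).[x] = 0 -> map_poly al q != 0 ->
        (size P <= size q)%N].

Lemma map_poly_drop_lead (p : {poly R}) :
  al (lead_coef p) = 0 ->
  map_poly al (p - lead_coef p *: 'X^((size p).-1)) = map_poly al p.
Proof. by move=> l0; rewrite rmorphB /= map_polyZ l0 scale0r subr0. Qed.

Lemma size_drop_lead (p : {poly R}) : p != 0 ->
  (size (p - lead_coef p *: 'X^((size p).-1))%R < size p)%N.
Proof.
move=> p0; have sp : (0 < size p)%N by rewrite size_poly_gt0.
rewrite -[ltnRHS](prednK sp) ltnS; apply/leq_sizeP=> j le_j.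
rewrite coefB coefZ coefXn; case: eqVneq => [->|ne_j].
  by rewrite mulr1 lead_coefE subrr.
rewrite mulr0 subr0 nth_default // -(prednK sp) ltn_neqAle eq_sym ne_j.
exact: le_j.
Qed.

(** A leading term killed by [al] could be dropped, leaving a shorter relation. *)
Lemma minimal_relation_lead P :
  minimal_relation P -> al (lead_coef P) != 0.
Proof.
case=> Px P0 minP; apply/eqP=> l0.
have P_neq0 : P != 0 by apply: contraNneq P0 => ->; rewrite rmorph0.
have := minP _ _ _; move/(_ (P - lead_coef P *: 'X^((size P).-1))).
rewrite map_poly_drop_lead // => /(_ Px P0).
by rewrite leqNgt size_drop_lead.
Qed.

Lemma minimal_relation_small P (q : {poly R}) : minimal_relation P ->
  (size q < size P)%N -> (map_poly al q).[x] = 0 -> map_poly al q = 0.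
Proof.
case=> _ _ minP lt_qP qx; apply/eqP; apply: contraTT lt_qP => q0.
by rewrite -leqNgt minP.
Qed.

Lemma map_pdiv (S : nzRingType) (ga : {rmorphism R -> S}) (p q : {poly R}) :
  ga (lead_coef q) ^+ scalp p q *: map_poly ga p =
    map_poly ga (p %/ q) * map_poly ga q + map_poly ga (p %% q).
Proof.
by rewrite -rmorphXn -map_polyZ Pdiv.Idomain.divp_eq rmorphD rmorphM.
Qed.

(* The minimal relation being irreducible, s(x) is invertible in the fraction
   field; clearing denominators gives the relation u s = d modulo it. *)
Lemma minimal_relation_bezout P s :
  minimal_relation P -> (map_poly al s).[x] != 0 ->
  exists u d, al d != 0 /\ (map_poly al u).[x] * (map_poly al s).[x] = al d.
Proof.
move=> mP sx; have lP := minimal_relation_lead _ mP.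
have [Px P0 minP] := mP.
have P_neq0 : P != 0 by apply: contraNneq P0 => ->; rewrite rmorph0.
(* Euclidean descent: among the [w] with [w(x)] a nonzero multiple of [s(x)], one of least size will
   turn out to be constant. *)
pose W w := (map_poly al w).[x] != 0 /\
  exists u, (map_poly al w).[x] = (map_poly al u).[x] * (map_poly al s).[x].
have Ws : W (s %% P).
  have /(congr1 (fun p => p.[x])) := map_pdiv _ al s P.
  rewrite !hornerE Px mulr0 add0r => Ds.
  split; first by rewrite -Ds mulf_neq0 ?expf_neq0.
  exists (lead_coef P ^+ scalp s P)%:P.
  by rewrite map_polyC hornerC /= rmorphXn.
have [w [[wx [u Du]] minw]] : exists w, W w /\ forall w', W w' ->
    (size w <= size w')%N by apply: ex_min_size; exists (s %% P).
have lt_wP : (size w < size P)%N.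
  by apply: leq_ltn_trans (minw _ Ws) _; rewrite Pdiv.Idomain.ltn_modp.
have w0 : w != 0 by apply: contraNneq wx => ->; rewrite rmorph0 horner0.
have lw : al (lead_coef w) != 0.
  apply/eqP=> l0.
  have := minw (w - lead_coef w *: 'X^((size w).-1)) _.
  rewrite /W map_poly_drop_lead // leqNgt size_drop_lead //= => H.
  by have := H (conj wx (ex_intro _ u Du)).
have [w1|w_gt1] := leqP (size w) 1.
  move: wx Du; rewrite (size1_polyC w1) map_polyC /= hornerC => wx Du.
  by exists u, w`_0.
(* If [w] is not constant, divide [P] by it. Minimality of [w] makes the remainder vanish at [x],
   minimality of [P] then kills the remainder and next the quotient, so [P] maps to 0, a
   contradiction. *)
have Dw := map_pdiv _ al P w.
have zx : (map_poly al (P %% w)).[x] = 0.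
  apply/eqP/negPn/negP=> zx.
  have /minw : W (P %% w).
    split=> //; exists (- (P %/ w * u)).
    move/(congr1 (fun p => p.[x])): Dw.
    rewrite !hornerE Px mulr0 => /eqP; rewrite addrC eq_sym addr_eq0 => /eqP->.
    by rewrite rmorphN rmorphM /= !hornerE Du mulNr mulrA.
  by rewrite leqNgt Pdiv.Idomain.ltn_modp w0.
have z0 : map_poly al (P %% w) = 0.
  apply: minimal_relation_small mP _ zx.
  by apply: ltn_trans lt_wP; rewrite Pdiv.Idomain.ltn_modp.
have tx : (map_poly al (P %/ w)).[x] = 0.
  move/(congr1 (fun p => p.[x])): Dw.
  rewrite z0 !hornerE Px mulr0 => /esym/eqP.
  by rewrite mulf_eq0 (negPf wx) orbF => /eqP.
have t0 : map_poly al (P %/ w) = 0.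
  apply: minimal_relation_small mP _ tx.
  rewrite Pdiv.Idomain.size_divp // ltn_subrL -subn1 subn_gt0 w_gt1.
  by rewrite size_poly_gt0.
move/eqP: Dw; rewrite z0 t0 mul0r addr0 scaler_eq0 (negPf P0) orbF.
by rewrite expf_eq0 (negPf lw) andbF.
Qed.

(** Take [c] to be the leading coefficient of [P] times the [d] of the relation [u s = d]. If the
    first factor survives under [be], pseudo-division by [P] carries every relation of [x] over to
    [om]; applied to [u s - d], this gives [s(om) != 0] as soon as [d] survives too. *)
Lemma adjoin_algebraic P s :
  minimal_relation P -> (map_poly al s).[x] != 0 ->
  exists c, al c != 0 /\
    forall be : {rmorphism R -> Om}, specializes be -> be c != 0 ->
      be (lead_coef P) != 0 /\
      forall om, root (map_poly be P) om ->
        (forall q, (map_poly al q).[x] = 0 -> (map_poly be q).[om] = 0) /\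
        (map_poly be s).[om] != 0.
Proof.
move=> mP sx; have lP := minimal_relation_lead _ mP.
have [u [d [d0 Dd]]] := minimal_relation_bezout P s mP sx.
have [Px P0 _] := mP.
have P_neq0 : P != 0 by apply: contraNneq P0 => ->; rewrite rmorph0.
exists (lead_coef P * d); split; first by rewrite rmorphM mulf_neq0.
move=> be spec; rewrite rmorphM mulf_eq0 negb_or => /andP[blP bd].
split=> // om /rootP Pom.
have ker q : (map_poly al q).[x] = 0 -> (map_poly be q).[om] = 0.
  move=> qx.
  have /(congr1 (fun p => p.[x])) := map_pdiv _ al q P.
  rewrite !hornerE Px qx !mulr0 add0r => /esym vx.
  have v0 : map_poly al (q %% P) = 0.
    by apply: minimal_relation_small mP _ vx; rewrite Pdiv.Idomain.ltn_modp.
  have /(congr1 (fun p => p.[om])) := map_pdiv _ be q P.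
  rewrite (specializes_map_poly be (q %% P)) // !hornerE Pom mulr0 => /eqP.
  by rewrite mulf_eq0 expf_eq0 (negPf blP) andbF => /eqP.
split=> //; apply: contraNneq bd => som.
have := ker (u * s - d%:P); rewrite !rmorphB !rmorphM /= !map_polyC !hornerE.
by rewrite Dd subrr som mulr0 sub0r => /(_ erefl)/eqP; rewrite oppr_eq0.
Qed.

Lemma adjoin_transcendental s :
  (forall q, (map_poly al q).[x] = 0 -> map_poly al q = 0) ->
  (map_poly al s).[x] != 0 ->
  exists c, al c != 0 /\
    forall be : {rmorphism R -> Om}, specializes be -> be c != 0 ->
      map_poly be s != 0 /\
      forall om q, (map_poly al q).[x] = 0 -> (map_poly be q).[om] = 0.
Proof.
move=> tr sx; have s0 : map_poly al s != 0.
  by apply: contraNneq sx => ->; rewrite horner0.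
(* This coefficient of [s] maps to the leading coefficient of its image under [al]; that of [s]
   itself may be killed by [al]. *)
exists s`_(size (map_poly al s)).-1.
rewrite -coef_map -lead_coefE lead_coef_eq0; split=> // be spec bc.
split=> [|om q /tr q0]; last by rewrite specializes_map_poly ?horner0.
by apply: contraNneq bc => b0; rewrite -coef_map b0 coef0.
Qed.

Lemma minimal_relationP :
  (forall q, (map_poly al q).[x] = 0 -> map_poly al q = 0) \/
  exists P, minimal_relation P.
Proof.
have [[q [qx q0]]|no_q] :=
  classic (exists q, (map_poly al q).[x] = 0 /\ map_poly al q != 0).
  right; have [|P [[Px P0] minP]] := ex_min_size R
    (fun q => (map_poly al q).[x] = 0 /\ map_poly al q != 0); first by exists q.
  by exists P; split=> // q' q'x q'0; apply: minP.
left=> q qx; apply/eqP/negPn/negP=> q0; apply: no_q.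
by exists q.
Qed.

Lemma minimal_relation_size P : minimal_relation P -> (1 < size P)%N.
Proof.
move=> mP; have lP := minimal_relation_lead _ mP.
have [Px _ _] := mP; rewrite ltnNge; apply: contraNN lP => P1.
move: Px; rewrite (size1_polyC P1) map_polyC hornerC /= lead_coefC.
by move=> ->.
Qed.

(** The condition [s != 0] over the ring with [x] adjoined is pulled back to a condition [c != 0]
    over [R], which is what lets the adjunctions be iterated. *)
Lemma adjoin_specialization s : (map_poly al s).[x] != 0 ->
  exists c, al c != 0 /\
    forall be : {rmorphism R -> Om}, specializes be -> be c != 0 ->
      exists om,
        (forall q, (map_poly al q).[x] = 0 -> (map_poly be q).[om] = 0) /\
        (map_poly be s).[om] != 0.
Proof.
move=> sx; have [tr|[P mP]] := minimal_relationP.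
  have [c [c0 Hc]] := adjoin_transcendental s tr sx.
  exists c; split=> // be spec bc; have [bs ker] := Hc be spec bc.
  by have [om som] := closed_nonrootP _ bs; exists om; split=> //; apply: ker.
have [c [c0 Hc]] := adjoin_algebraic P s mP sx.
exists c; split=> // be spec bc; have [blP HP] := Hc be spec bc.
have /closed_rootP[om Pom] : size (map_poly be P) != 1%N.
  rewrite size_map_poly_id0 // neq_ltn.
  by rewrite minimal_relation_size // orbT.
by exists om; apply: HP.
Qed.

End Specialization.

(** * The embedding of Q in K, and partial homomorphisms *)

(** [ratr] divides by the image of the denominator. In characteristic 0 this image is nonzero, so
    identities can be checked after clearing denominators. *)
Lemma ratr_rmorphism (K : fieldType) (charK0 : [pchar K] =i pred0) :
  exists phi : {rmorphism rat -> K}, phi = @ratr K :> (rat -> K).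
Proof.
have /pcharf0P natK := charK0.
have intK (z : int) : (z%:~R == 0 :> K) = (z == 0).
  by case: z => n; rewrite ?NegzE ?mulrNz ?oppr_eq0 -pmulrn natK ?oppr_eq0.
have denK (q : rat) : (denq q)%:~R != 0 :> K by rewrite intK denq_neq0.
have ratrK (q : rat) : ratr q * (denq q)%:~R = (numq q)%:~R :> K.
  by rewrite /ratr divfK.
have nzd (q : rat) : (denq q)%:~R != 0 :> rat by rewrite intr_eq0 denq_neq0.
have Dnum (q : rat) : q * (denq q)%:~R = (numq q)%:~R.
  by rewrite -[X in X * _](divq_num_den q) divfK.
have ratr_frac (q : rat) (a b : int) :
    q * b%:~R = a%:~R -> b != 0 -> ratr q * b%:~R = a%:~R :> K.
  move=> Dq b0; apply: (mulIf (denK q)).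
  rewrite mulrAC ratrK -!intrM; congr (_%:~R).
  by apply: (@intr_inj rat); rewrite !intrM -Dq -Dnum mulrAC.
have ratrB : zmod_morphism (@ratr K).
  move=> a b; apply: (mulIf (denK a)); apply: (mulIf (denK b)).
  rewrite -mulrA -intrM.
  rewrite (ratr_frac _ (numq a * denq b - numq b * denq a)) ?mulf_neq0 //.
    by rewrite intrB !intrM -!ratrK; ring.
  by rewrite intrB !intrM -!Dnum; ring.
have ratrM : monoid_morphism (@ratr K).
  split=> [|a b]; first by rewrite /ratr divr1.
  apply: (mulIf (denK a)); apply: (mulIf (denK b)).
  rewrite -mulrA -intrM (ratr_frac _ (numq a * numq b)) ?mulf_neq0 //.
    by rewrite intrM -!ratrK; ring.
  by rewrite !intrM -!Dnum; ring.
pose addM := GRing.isZmodMorphism.Build rat K (@ratr K) ratrB.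
pose mulM := GRing.isMonoidMorphism.Build rat K (@ratr K) ratrM.
by exists (HB.pack_for {rmorphism rat -> K} (@ratr K) addM mulM).
Qed.

(** Conditions (1)-(3) of adequacy with an arbitrary target field: the values are first algebraic
    numbers and are later moved into [K]. *)
Definition partial_hom (K L : fieldType) (A : seq K) (f : K -> L) : Prop :=
  [/\ 1 \in A -> f 1 = 1,
      forall a b, a \in A -> b \in A -> a + b \in A -> f (a + b) = f a + f b
    & forall a b, a \in A -> b \in A -> a * b \in A -> f (a * b) = f a * f b].

Lemma partial_hom_comp (K L M : fieldType) (A : seq K) (B : seq L)
    (f : K -> L) (h : L -> M) :
  {subset map f A <= B} -> partial_hom K L A f -> partial_hom L M B h ->
  partial_hom K M A (h \o f).
Proof.
move=> sAB [f1 fD fM] [h1 hD hM].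
have inB a : a \in A -> f a \in B by move=> Aa; apply/sAB/map_f.
split=> [A1|a b Aa Ab Aab|a b Aa Ab Aab] /=.
- by rewrite f1 // h1 // -f1 // inB.
- by rewrite fD // hD ?inB // -fD // inB.
- by rewrite fM // hM ?inB // -fM // inB.
Qed.

(** * Two homomorphisms separating an irrational r *)

Section TwoSpecializations.

Variables (K : fieldType) (Om : closedFieldType).
Variables (phi : {rmorphism rat -> K}) (psi : {rmorphism rat -> Om}).
Variables (r : K) (r_irr : forall c, phi c <> r).

(** A transcendental [r] can go to any two non-roots of [s]. An algebraic one can go to two distinct
    roots of its minimal relation, which has degree at least 2 and simple roots. *)
Lemma irrational_two_specializations s : (map_poly phi s).[r] != 0 ->
  exists om1 om2 : Om, om1 != om2 /\ forall om, om \in [:: om1; om2] ->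
    (forall q, (map_poly phi q).[r] = 0 -> (map_poly psi q).[om] = 0) /\
    (map_poly psi s).[om] != 0.
Proof.
have spec : specializes rat K Om phi psi.
  by move=> t /eqP; rewrite fmorph_eq0 => /eqP->; rewrite rmorph0.
move=> sr; have [tr|[P mP]] := minimal_relationP rat K phi r.
  have [c [c0 Hc]] := adjoin_transcendental rat K Om phi r s tr sr.
  have [|s0 ker] := Hc psi spec; first by rewrite fmorph_eq0 -(fmorph_eq0 phi).
  have [om1 s1] := closed_nonrootP _ s0.
  have s0' : map_poly psi s * ('X - om1%:P) != 0.
    by rewrite mulf_neq0 // polyXsubC_eq0.
  have [om2] := closed_nonrootP _ s0'.
  rewrite rootM root_XsubC negb_or => /andP[s2 ne21].
  exists om1, om2; split; first by rewrite eq_sym.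
  by move=> om; rewrite !inE => /orP[]/eqP->; split=> //; apply: ker.
have [Pr P0 minP] := mP.
have P_neq0 : P != 0 by apply: contraNneq P0 => ->; rewrite rmorph0.
have P_gt1 := minimal_relation_size _ _ _ _ _ mP.
have lP := minimal_relation_lead _ _ _ _ _ mP.
(* A relation of degree one would make [r] rational. *)
have P_gt2 : (2 < size P)%N.
  rewrite ltn_neqAle P_gt1 andbT eq_sym; apply/eqP=> P2.
  apply: (r_irr (- P`_0 / P`_1)).
  have P1 : phi P`_1 != 0 by move: lP; rewrite lead_coefE P2.
  apply: (mulIf P1); rewrite fmorph_div rmorphN divfK //.
  move: Pr; rewrite horner_coef size_map_poly P2 !big_ord_recl big_ord0 /=.
  rewrite !coef_map /= expr0 mulr1 expr1 addr0 => /eqP.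
  by rewrite addrC addr_eq0 mulrC => /eqP->.
have dP0 : P^`() != 0.
  apply/eqP=> d0; have := coef_deriv P (size P).-2.
  rewrite d0 coef0 !prednK -?subn1 ?subn_gt0 // => /esym/eqP.
  by rewrite Num.Theory.mulrn_eq0 subn_eq0 leqNgt P_gt1 subn1 -lead_coefE lead_coef_eq0
    (negPf P_neq0).
have dPr : (map_poly phi P^`()).[r] != 0.
  apply/eqP=> dPr; have := minP _ dPr; rewrite map_poly_eq0 => /(_ dP0).
  by rewrite leqNgt lt_size_deriv.
(* Including the derivative in the polynomial to be kept nonzero makes all roots of [P] in [Om]
   simple. *)
have sdPr : (map_poly phi (s * P^`())).[r] != 0.
  by rewrite rmorphM hornerM mulf_neq0.
have [c [c0 Hc]] := adjoin_algebraic rat K Om phi r P _ mP sdPr.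
have [|bP HP] := Hc psi spec; first by rewrite fmorph_eq0 -(fmorph_eq0 phi).
have good om : root (map_poly psi P) om ->
    [/\ forall q, (map_poly phi q).[r] = 0 -> (map_poly psi q).[om] = 0,
        (map_poly psi s).[om] != 0 & (map_poly psi P^`()).[om] != 0].
  move=> /HP[ker]; rewrite rmorphM hornerM mulf_eq0 negb_or.
  by case/andP.
have /closed_rootP[om1 Pom1] : size (map_poly psi P) != 1%N.
  by rewrite size_map_poly neq_ltn P_gt1 orbT.
have [Q DP] := factor_theorem _ _ Pom1.
have Q0 : Q != 0.
  apply: contraTneq P_neq0 => Q0.
  by rewrite -(map_poly_eq0 psi) DP Q0 mul0r eqxx.
(* A root of the cofactor [Q] is again a root of [P], and differs from [om1] because [om1] is
   simple. *)
have /closed_rootP[om2 Qom2] : size Q != 1%N.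
  apply: contraTneq P_gt2 => Q1.
  by rewrite -(size_map_poly psi) DP size_Mmonic ?monicXsubC // size_XsubC Q1.
have Pom2 : root (map_poly psi P) om2 by rewrite DP rootM Qom2.
exists om1, om2; split.
  apply: contraTneq Qom2 => <-.
  have [_ _] := good _ Pom1; rewrite -deriv_map DP derivM derivXsubC mulr1.
  by rewrite !hornerE subrr mulr0 add0r.
have [k1 s1 _] := good _ Pom1; have [k2 s2 _] := good _ Pom2.
by move=> om; rewrite !inE => /orP[]/eqP->.
Qed.

(** [R] is an iterated polynomial ring over Q with one variable [rho] for [r] and one for each entry
    of [A]; [g] picks a preimage of each element of [A]. The arbitrary [s] strengthens the
    induction: each adjunction requires some [c] below to be avoided. *)
Lemma tower_specializations (A : seq K) :
  exists (R : idomainType) (al : {rmorphism R -> K}) (rho : R) (g : K -> R),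
  [/\ al rho = r, {in A, cancel g al}
    & forall s, al s != 0 -> exists be1 be2 : {rmorphism R -> Om},
        [/\ specializes R K Om al be1, specializes R K Om al be2,
            be1 s != 0, be2 s != 0 & be1 rho != be2 rho]].
Proof.
elim: A => [|a A [R [al [rho [g [al_rho gK H]]]]]].
  exists {poly rat}, (horner_eval r \o map_poly phi), 'X, (fun=> 0).
  split=> //=; first by rewrite /horner_eval map_polyX hornerX.
  move=> s /irrational_two_specializations[om1 [om2 [ne12 Hom]]].
  exists (horner_eval om1 \o map_poly psi), (horner_eval om2 \o map_poly psi).
  have [k1 s1] := Hom om1 (mem_head _ _).
  have [k2 s2] := Hom om2 (mem_last om1 [:: om2]).
  by split=> //=; rewrite /horner_eval map_polyX !hornerX.
exists {poly R}, (horner_eval a \o map_poly al), rho%:P.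
exists (fun y => if y == a then 'X else (g y)%:P).
split=> [|y|s sa] /=.
- by rewrite /horner_eval map_polyC hornerC.
- rewrite inE /horner_eval; case: eqP => [-> _|_ /= Ay].
    by rewrite map_polyX hornerX.
  by rewrite map_polyC hornerC /= gK.
have [c [c0 Hc]] := adjoin_specialization R K Om al a s sa.
have [be1 [be2 [sp1 sp2 c1 c2 ne12]]] := H c c0.
have [om1 [k1 s1]] := Hc be1 sp1 c1; have [om2 [k2 s2]] := Hc be2 sp2 c2.
exists (horner_eval om1 \o map_poly be1), (horner_eval om2 \o map_poly be2).
by split=> //=; rewrite /horner_eval !map_polyC !hornerC.
Qed.

Lemma irrational_two_partial_homs (A : seq K) : r \in A ->
  exists f1 f2 : K -> Om,
    [/\ partial_hom K Om A f1, partial_hom K Om A f2 & f1 r != f2 r].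
Proof.
move=> Ar; have [R [al [rho [g [al_rho gK H]]]]] := tower_specializations A.
have [|be1 [be2 [sp1 sp2 _ _ ne12]]] := H 1; first by rewrite rmorph1 oner_neq0.
have hom (be : {rmorphism R -> Om}) : specializes R K Om al be ->
    partial_hom K Om A (be \o g) /\ be (g r) = be rho.
  (* [be] depends only on the image in [K]; hence [be \o g] respects sums and products, and [g r]
     may be replaced by [rho]. *)
  move=> sp; have sub t u : al t = al u -> be t = be u.
    move=> tu; apply/eqP; rewrite -subr_eq0 -rmorphB; apply/eqP/sp.
    by rewrite rmorphB tu subrr.
  split; last by apply: sub; rewrite gK.
  split=> [A1|a b Aa Ab Aab|a b Aa Ab Aab] /=.
  - by rewrite -(rmorph1 be); apply: sub; rewrite gK // rmorph1.
  - by rewrite -rmorphD; apply: sub; rewrite rmorphD !gK.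
  - by rewrite -rmorphM; apply: sub; rewrite rmorphM !gK.
have [h1 r1] := hom _ sp1; have [h2 r2] := hom _ sp2.
by exists (be1 \o g), (be2 \o g); split; rewrite //= r1 r2.
Qed.

End TwoSpecializations.

(** * The case where every nonconstant rational polynomial has a root in K *)

Section RootsInK.

Variables (K : fieldType) (phi : {rmorphism rat -> K}).

(* All of [s] lies in a number field Q(z); a root in K of the minimal
   polynomial of z defines an embedding of that field into K. *)
Lemma algC_partial_embedding (s : seq algC) :
  (forall p : {poly rat}, (1 < size p)%N ->
     exists x, root (map_poly phi p) x) ->
  exists h : algC -> K, partial_hom algC K s h /\ {in s &, injective h}.
Proof.
move=> rootK; have [z _ [ps Ds]] := algC_PET s.
have [p [Dp mon_p] pP] := minCpolyP z.
have pz : root (map_poly ratr p) z by rewrite pP dvdpp.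
have p_gt1 : (1 < size p)%N.
  rewrite -(size_map_poly (@ratr algC)) (root_size_gt1 _ pz) //.
  by rewrite map_poly_eq0 monic_neq0.
have [z' pz'] := rootK p p_gt1.
pose P y := nth 0 ps (index y s).
have PK y : y \in s -> (map_poly ratr (P y)).[z] = y.
  move=> sy; have lt_i : (index y s < size ps)%N.
    rewrite -(size_map (fun p => (map_poly (@ratr algC) p).[z])) -Ds.
    by rewrite index_mem.
  by rewrite -[RHS](nth_index 0 sy) [X in nth 0 X _]Ds (nth_map 0).
(* [z] and [z'] satisfy the same equations over Q. If [q(z') = 0], write [p = u gcd(p, q)]: either
   [p] divides the gcd, hence [q], or [p] divides [u], the gcd is constant, and Bezout contradicts
   the common root [z']. *)
have transfer q : ((map_poly ratr q).[z] == 0) = ((map_poly phi q).[z'] == 0).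
  rewrite -!rootE pP; apply/idP/idP=> [|qz'].
    by case/dvdpP=> u ->; rewrite rmorphM rootM pz' orbT.
  have p0 := monic_neq0 mon_p.
  have /dvdpP[u Du] := dvdp_gcdl p q.
  have : root (map_poly ratr (u * gcdp p q)) z by rewrite -Du.
  rewrite rmorphM rootM !pP => /orP[dv|/dvdp_trans]; last first.
    by apply; apply: dvdp_gcdr.
  have /andP[u0 g0] : (u != 0) && (gcdp p q != 0).
    by rewrite -negb_or -mulf_eq0 -Du.
  have g1 : size (gcdp p q) == 1%N.
    have := dvdp_leq u0 dv; rewrite {1}Du size_mul //.
    have := size_poly_gt0 (gcdp p q); rewrite g0.
    case: (size _) => [|[|n]] // _; rewrite addnS addnS /=.
    by rewrite ltnNge leq_addr.
  have /Bezout_eq1_coprimepP[[v w] /= vw] := g1.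
  have := congr1 (fun t => (map_poly phi t).[z']) vw.
  rewrite rmorphD !rmorphM rmorph1 /= !hornerE (rootP pz') (rootP qz') !mulr0.
  by rewrite addr0 => /eqP; rewrite eq_sym oner_eq0.
pose h y := (map_poly phi (P y)).[z'].
have transferB q q' : ((map_poly ratr q).[z] == (map_poly ratr q').[z])
    = ((map_poly phi q).[z'] == (map_poly phi q').[z']).
  rewrite -[LHS]subr_eq0 -[RHS]subr_eq0 -!hornerN -!hornerD -!rmorphB.
  exact: transfer.
exists h; split.
  split=> [s1|a b sa sb sab|a b sa sb sab].
  - have := transferB (P 1) 1; rewrite PK // !rmorph1 !hornerC eqxx => /esym.
    by move/eqP.
  - have := transferB (P (a + b)) (P a + P b).
    by rewrite !rmorphD !hornerD !PK // eqxx => /esym/eqP.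
  - have := transferB (P (a * b)) (P a * P b).
    by rewrite !rmorphM !hornerM !PK // eqxx => /esym/eqP.
move=> a b sa sb /eqP; rewrite -transferB !PK //.
by move/eqP.
Qed.

Lemma tildeK_rational (r : K) :
  (forall p : {poly rat}, (1 < size p)%N ->
     exists x, root (map_poly phi p) x) ->
  tildeK r -> exists c, phi c = r.
Proof.
move=> rootK [A [Ar adq]]; apply: NNPP => r_irr.
have {}r_irr c : phi c <> r by move=> rc; apply: r_irr; exists c.
have [f1 [f2 [h1 h2 ne12]]] :=
  irrational_two_partial_homs K algC phi ratr r r_irr A Ar.
(* A single embedding covers the values of both maps, so injectivity applies to the pair [f1 r],
   [f2 r], both of which adequacy sends to [r]. *)
have [h [hh h_inj]] := algC_partial_embedding (map f1 A ++ map f2 A) rootK.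
have fix_r f : {subset map f A <= map f1 A ++ map f2 A} ->
    partial_hom K algC A f -> h (f r) = r.
  move=> sub hf; have [e1 eD eM] := partial_hom_comp _ _ _ _ _ _ _ sub hf hh.
  exact: adq e1 eD eM.
case/eqP: ne12; apply: h_inj; rewrite ?mem_cat ?map_f ?orbT //.
by rewrite !fix_r // => y; rewrite mem_cat => ->; rewrite ?orbT.
Qed.

End RootsInK.

(** * Merging equations when some polynomial has no root in K *)

Section CombineEquations.

Variables (K : fieldType) (phi : {rmorphism rat -> K}).
Variables (p : {poly rat}) (p_gt1 : (1 < size p)%N).
Hypothesis p_noroot : forall x, ~~ root (map_poly phi p) x.

(* The homogenization b^n p(a/b), n = deg p, vanishes only at the origin. *)
Lemma homogenization_eq0 (a b : K) :
  (\sum_(i < size p) phi p`_i * (a ^+ i * b ^+ ((size p).-1 - i)) == 0)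
    = (a == 0) && (b == 0).
Proof.
have p0 : p != 0 by rewrite -size_poly_gt0 ltnW.
have sp : size p = (size p).-1.+1 by rewrite prednK // ltnW.
have n0 : (0 < (size p).-1)%N by rewrite -ltnS -sp.
have [->|b0] := eqVneq b 0.
  (* For [b = 0] only the top term, the leading coefficient times [a^n], survives; otherwise the sum
     is [b^n p(a/b)]. *)
  rewrite andbT sp big_ord_recr /= subnn expr0 mulr1 big1 ?add0r => [|i _].
    rewrite mulf_eq0 expf_eq0 n0 fmorph_eq0 -lead_coefE lead_coef_eq0.
    by rewrite (negPf p0).
  by rewrite [0 ^+ _]expr0n subn_eq0 leqNgt ltn_ord !mulr0.
rewrite andbF; apply/negbTE; have := p_noroot (a / b).
apply: contraNneq => H; apply/rootP.
apply: (mulIf (expf_neq0 (size p).-1 b0)); rewrite mul0r -[RHS]H.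
rewrite horner_coef size_map_poly mulr_suml; apply: eq_bigr => i _.
rewrite coef_map -mulrA; congr (_ * _); rewrite expr_div_n -mulrA.
congr (_ * _); have le_i : (i <= (size p).-1)%N by rewrite -ltnS -sp.
by rewrite -[X in _ * b ^+ X = _](subnKC le_i) exprD mulKf ?expf_neq0.
Qed.

(** Each equation [t = 0] is absorbed into the current [T = 0] by the homogenization of [p] at the
    pair [(t, T)]; the empty system is the equation [0 = 0]. *)
Lemma combine_equations (n : nat) (Ts : seq {mpoly rat[n]}) :
  exists T : {mpoly rat[n]}, forall v : 'I_n -> K,
    (mmap phi v T == 0) = all (fun t => mmap phi v t == 0) Ts.
Proof.
elim: Ts => [|t Ts [T HT]]; first by exists 0 => v; rewrite mmap0 eqxx.
exists (\sum_(i < size p) p`_i *: (t ^+ i * T ^+ ((size p).-1 - i))) => v /=.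
rewrite -HT -homogenization_eq0 raddf_sum; congr (_ == 0).
by apply: eq_bigr => i _; rewrite /= mmapZ rmorphM !rmorphXn.
Qed.

End CombineEquations.

(** * The polynomial system describing maps on A *)

Section System.

Variables (K : fieldType) (phi : {rmorphism rat -> K}) (A : seq K) (r : K).
Variables (n : nat) (sizeA : size A = n.+1).

(** Variable 0 is reserved for [x], hence the [lift]. Outside [A] the index is out of range and
    [inord] falls back to 0, so the equations below are filtered by membership. *)
Let X (a : K) : {mpoly rat[n.+2]} := 'X_(lift ord0 (inord (index a A))).

Definition hom_equations : seq {mpoly rat[n.+2]} :=
  ('X_ord0 - X r) ::
  (if 1 \in A then [:: X 1 - 1] else [::]) ++
  [seq X (ab.1 + ab.2) - (X ab.1 + X ab.2)
     | ab <- [seq (a, b) | a <- A, b <- A] & ab.1 + ab.2 \in A] ++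
  [seq X (ab.1 * ab.2) - X ab.1 * X ab.2
     | ab <- [seq (a, b) | a <- A, b <- A] & ab.1 * ab.2 \in A].

Lemma hom_equationsP (x : K) (xs : 'I_n.+1 -> K) :
  let f a := xs (inord (index a A)) in
  all (fun t => mmap phi (valx x xs) t == 0) hom_equations <->
  x = f r /\ partial_hom K K A f.
Proof.
move=> f.
have evX a : mmap phi (valx x xs) (X a) = f a.
  by rewrite mmapX mmap1U /valx liftK.
have ev0 : mmap phi (valx x xs) 'X_ord0 = x.
  by rewrite mmapX mmap1U /valx unlift_none.
have evB t u : (mmap phi (valx x xs) (t - u) == 0) =
    (mmap phi (valx x xs) t == mmap phi (valx x xs) u).
  by rewrite rmorphB subr_eq0.
rewrite /= evB ev0 evX !all_cat.
have -> : all (fun t => mmap phi (valx x xs) t == 0)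
    (if 1 \in A then [:: X 1 - 1] else [::]) = (1 \in A) ==> (f 1 == 1).
  by case: ifP => //= _; rewrite evB evX rmorph1 andbT.
split=> [/and4P[/eqP Dx /implyP f1 /allP fD /allP fM]|[Dx [f1 fD fM]]].
  split=> //; split=> [/f1/eqP//|a b Aa Ab Aab|a b Aa Ab Aab].
    have /fD : X (a + b) - (X a + X b) \in
        [seq X (ab.1 + ab.2) - (X ab.1 + X ab.2)
           | ab <- [seq (a, b) | a <- A, b <- A] & ab.1 + ab.2 \in A].
      by apply/mapP; exists (a, b); rewrite // mem_filter Aab allpairs_f.
    by rewrite evB rmorphD /= !evX => /eqP.
  have /fM : X (a * b) - X a * X b \in
      [seq X (ab.1 * ab.2) - X ab.1 * X ab.2
         | ab <- [seq (a, b) | a <- A, b <- A] & ab.1 * ab.2 \in A].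
    by apply/mapP; exists (a, b); rewrite // mem_filter Aab allpairs_f.
  by rewrite evB rmorphM /= !evX => /eqP.
apply/and4P; split; first exact/eqP.
  by apply/implyP=> /f1->.
  apply/allP=> t /mapP[ab /[!mem_filter]/andP[Aab /allpairsP[[a b]]]].
  move=> [Aa Ab Dab] ->; subst ab.
  by rewrite evB rmorphD /= !evX fD.
apply/allP=> t /mapP[ab /[!mem_filter]/andP[Aab /allpairsP[[a b]]]].
move=> [Aa Ab Dab] ->; subst ab.
by rewrite evB rmorphM /= !evX fM.
Qed.

Lemma hom_equations_adequate (x : K) : adequate r A ->
  x = r <-> exists xs : 'I_n.+1 -> K,
    all (fun t => mmap phi (valx x xs) t == 0) hom_equations.
Proof.
case=> Ar adq; split=> [->|[xs /hom_equationsP[-> [f1 fD fM]]]].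
  (* For [x = r] the identity map on [A] is a solution. *)
  exists (fun j => nth 0 A j); apply/hom_equationsP.
  have nthA a : a \in A -> nth 0 A (inord (index a A) : 'I_n.+1) = a.
    by move=> Aa; rewrite inordK ?nth_index // -sizeA index_mem.
  by rewrite nthA //; split=> //; split=> *; rewrite !nthA.
exact: adq f1 fD fM.
Qed.

End System.

(* K a field containing Q, i.e. of characteristic 0. *)
Theorem theorem5 (K : fieldType) (charK0 : [pchar K] =i pred0) (r : K)
  (hr : tildeK r) :
  exists (m : nat) (T : {mpoly rat[m.+1]}),
    (1 <= m)%N /\
    forall x : K, x = r <-> exists xs : 'I_m -> K, evalQ T x xs = 0.
Proof.
have [phi Dphi] := ratr_rmorphism K charK0.
have evE m (T : {mpoly rat[m.+1]}) (x : K) xs :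
    evalQ T x xs = mmap phi (valx x xs) T by rewrite Dphi.
(* If some nonconstant [p] has no root in [K], the whole system merges into one equation, with one
   unknown for each entry of [A]. *)
have [[p [p_gt1 p_noroot]]|no_p] := classic (exists p : {poly rat},
    (1 < size p)%N /\ forall x, ~~ root (map_poly phi p) x).
  have [A adq] := hr; have [Ar _] := adq.
  have sizeA : size A = (size A).-1.+1 by case: (A) Ar.
  have [T HT] := combine_equations K phi p p_gt1 p_noroot _
    (hom_equations K A r (size A).-1).
  exists (size A).-1.+1, T; split=> // x.
  rewrite (hom_equations_adequate K phi A r _ sizeA x adq).
  split=> -[xs]; exists xs; first by rewrite evE; apply/eqP; rewrite HT.
  by rewrite -HT -evE; apply/eqP.
have [|c Dr] := tildeK_rational K phi r _ hr.
  move=> p p_gt1; apply: NNPP => no_root; apply: no_p.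
  exists p; split=> // x; apply/negP=> px; apply: no_root.
  by exists x.
(* Here [r] is the rational [c]; the unknown [x_1] is a dummy that meets the bound [m >= 1]. *)
exists 1%N, ('X_ord0 - c%:MP); split=> // x.
have ev xs : evalQ ('X_ord0 - c%:MP) x xs = x - r.
  by rewrite evE rmorphB /= mmapX mmap1U mmapC /= Dr /valx unlift_none.
split=> [Dx|[xs]]; first by exists (fun=> 0); rewrite ev Dx subrr.
by rewrite ev => /eqP; rewrite subr_eq0 => /eqP.
Qed.
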